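(* Let $X=X_1\otimes\cdots\otimes X_k$ and $Y=Y_1\otimes\cdots\otimes Y_k$, with $X_i,Y_i\in M_{n_i}(\mathbb{C})_{++}$ for $i=1,\dots,k$. If $$\operatorname{OLC}(XY)=\operatorname{OLC}(X)+\operatorname{OLC}(Y),$$ then $\kappa(X_iY_i)=\kappa(X_i)\kappa(Y_i)$ for every $i=1,\dots,k$. In particular, if $n_i\le3$ for every $i$, then $X_iY_i=Y_iX_i$ for every $i$, and consequently $XY=YX$.
   Context: $M_n(\mathbb{C})_{++}$ denotes the positive definite (Hermitian, invertible) $n\times n$ complex matrices; $\otimes$ is the Kronecker product. For an invertible matrix $A$, with $\|\cdot\|$ the operator (spectral) norm, $\kappa(A):=\|A\|\,\|A^{-1}\|$ and $\operatorname{OLC}(A):=\tfrac12\ln\kappa(A)$. *)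

(* Defs.v *)
From HB Require Import structures.
From mathcomp Require Import all_boot all_order all_algebra.
From mathcomp Require Import all_classical all_reals all_analysis.
From mathcomp Require Import complex mxtens.

Set Implicit Arguments.
Unset Strict Implicit.
Unset Printing Implicit Defensive.

Import Order.TTheory GRing.Theory Num.Theory.
Local Open Scope ring_scope.
Local Open Scope classical_set_scope.
Local Open Scope sesquilinear_scope.
Local Open Scope complex_scope.

(* In R[i], [0 < z] says that z is real and positive. *)
Definition posdefmx (R : realType) (n : nat) (A : 'M[R[i]]_n) : Prop :=
  A \is hermsymmx /\
  forall v : 'cV[R[i]]_n, v != 0 -> 0 < (v ^t* *m A *m v) 0 0.

(* The norm the library puts on matrices is the sup norm, and the norm of R[i]
   takes its values in R[i]; [Normc.normc] is the R-valued modulus. *)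
Definition norm2 (R : realType) (n : nat) (v : 'cV[R[i]]_n) : R :=
  Num.sqrt (\sum_(i < n) Normc.normc (v i 0) ^+ 2).

Definition opnorm (R : realType) (n : nat) (A : 'M[R[i]]_n) : R :=
  sup [set norm2 (A *m v) | v in [set v : 'cV[R[i]]_n | norm2 v <= 1]].

(* [invmx A] is the inverse only for A \in unitmx; kappa and OLC are meant for
   such A. *)
Definition kappa (R : realType) (n : nat) (A : 'M[R[i]]_n) : R :=
  opnorm A * opnorm (invmx A).

Definition OLC (R : realType) (n : nat) (A : 'M[R[i]]_n) : R :=
  2^-1 * ln (kappa A).

(* Kronecker product of k.+1 >= 1 square matrices, X_0 *t (X_1 *t (... *t X_k)),
   and its size n_0 * (n_1 * (... * n_k)). *)
Fixpoint kron_size (k : nat) : ('I_k.+1 -> nat) -> nat :=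
  match k return ('I_k.+1 -> nat) -> nat with
  | 0%N => fun n => n ord0
  | k'.+1 => fun n => (n ord0 * kron_size (fun i => n (lift ord0 i)))%N
  end.

Fixpoint kron (T : pzRingType) (k : nat) :
    forall n : 'I_k.+1 -> nat, (forall i, 'M[T]_(n i)) -> 'M[T]_(kron_size n) :=
  match k return forall n : 'I_k.+1 -> nat,
      (forall i, 'M[T]_(n i)) -> 'M[T]_(kron_size n) with
  | 0%N => fun n X => X ord0
  | k'.+1 => fun n X => X ord0 *t kron (fun i => X (lift ord0 i))
  end.

(* Main.v *)
(* The operator norm is attained and multiplicative for Kronecker products, so
   [kappa (kron X)] is the product of the [kappa (X i)]. As [kappa] is
   submultiplicative, equality of the products over [i] forces equality for
   each [i].
   For positive definite A and B, kappa (AB) = kappa A kappa B gives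
   |AB| = |A||B| and |B^-1 A^-1| = |B^-1||A^-1|; a vector attaining |AB| is then
   a common eigenvector of A and B for their largest eigenvalues, and similarly
   there is one for the smallest eigenvalues. Unless A is scalar these two are
   independent, so AB - BA has rank at most 1 when the dimension is at most 3.
   It is also skew-Hermitian of trace 0, hence 0. *)

Require Import Defs.
From mathcomp Require Import all_boot all_order all_algebra.
From mathcomp Require Import all_classical all_reals all_analysis.
From mathcomp Require Import complex mxtens ring.
Import Order.TTheory GRing.Theory Num.Theory.
Local Open Scope ring_scope.
Local Open Scope complex_scope.
Local Open Scope sesquilinear_scope.

Set Implicit Arguments.
Unset Strict Implicit.
Unset Printing Implicit Defensive.

(** * The Euclidean norm on complex vectors *)

Lemma norm2_ge0 (R : realType) n (v : 'cV[R[i]]_n) : 0 <= norm2 v.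
Proof. exact: sqrtr_ge0. Qed.

Lemma norm2_sqr (R : realType) n (v : 'cV[R[i]]_n) :
  norm2 v ^+ 2 = \sum_(i < n) Normc.normc (v i 0) ^+ 2.
Proof. by rewrite sqr_sqrtr // sumr_ge0 // => i _; rewrite sqr_ge0. Qed.

(** Links the real-valued norm to the Hermitian form, which lives in [R[i]]; norm identities are
    proved there and pulled back along the injective [%:C]. *)
Lemma norm2_dot (R : realType) n (v : 'cV[R[i]]_n) :
  (norm2 v ^+ 2)%:C = (v^t* *m v) 0 0.
Proof.
rewrite norm2_sqr rmorph_sum /= mxE; apply: eq_bigr => i _.
by rewrite !mxE mulrC -normCK rmorphXn.
Qed.

Lemma norm2_eq0 (R : realType) n (v : 'cV[R[i]]_n) : norm2 v = 0 -> v = 0.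
Proof.
move=> v0; have /eqP := norm2_sqr v; rewrite v0 expr0n /= eq_sym psumr_eq0.
  move=> /allP v_eq0; apply/colP => i; rewrite mxE.
  have /(_ (mem_index_enum _)) := v_eq0 i.
  by rewrite sqrf_eq0 => /eqP /Normc.eq0_normc.
by move=> i _; rewrite sqr_ge0.
Qed.

Lemma norm2Z (R : realType) n (c : R[i]) (v : 'cV[R[i]]_n) :
  norm2 (c *: v) = Normc.normc c * norm2 v.
Proof.
apply/eqP; rewrite -(@eqrXn2 _ 2) ?norm2_ge0 ?mulr_ge0 ?norm2_ge0 //; last first.
  by case: c => a b; exact: sqrtr_ge0.
rewrite exprMn !norm2_sqr mulr_sumr; apply/eqP; apply: eq_bigr => i _.
by rewrite mxE Normc.normcM exprMn.
Qed.

Lemma norm2_unitary (R : realType) n (P : 'M[R[i]]_n) (v : 'cV[R[i]]_n) :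
  P \is unitarymx -> norm2 (P *m v) = norm2 v.
Proof.
move=> uP; apply/eqP; rewrite -(@eqrXn2 _ 2) ?norm2_ge0 // -(inj_eq (@complexI R)).
rewrite !norm2_dot trmx_mul map_mxM /= mulmxA -[_ *m _ *m P]mulmxA.
by rewrite -invmx_unitary // mulVmx ?unitarymx_unit // mulmx1.
Qed.

Lemma norm2_delta (R : realType) n (i : 'I_n) :
  norm2 (delta_mx i 0 : 'cV[R[i]]_n) = 1.
Proof.
apply/eqP; rewrite -(@eqrXn2 _ 2) ?norm2_ge0 // -(inj_eq (@complexI R)) norm2_dot.
by rewrite trmx_delta map_delta_mx mul_delta_mx mxE !eqxx /= expr1n.
Qed.

(** * The operator norm as a maximum *)

(** Unitary diagonalisation of the normal matrix [A^t* *m A] turns the form [w^t* *m A^t* *m A *m w]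
    into a weighted sum of squares of the coordinates of [P *m w]. *)
Lemma norm2_mul_spectral (R : realType) n (A : 'M[R[i]]_n) :
  exists2 P : 'M[R[i]]_n, P \is unitarymx & exists d : 'I_n -> R,
    forall w, norm2 (A *m w) ^+ 2 =
      \sum_i d i * Normc.normc ((P *m w) i 0) ^+ 2.
Proof.
set H := A^t* *m A.
have nH : H \is normalmx.
  apply/normalmxP; suff -> : H^t* = H by [].
  by rewrite /H trmx_mul map_mxM /= trmxCK.
have /orthomx_spectralP := nH.
set P := spectralmx H; set d := spectral_diag H => HE.
have uP : P \is unitarymx := spectral_unitarymx H.
have AwE w : (norm2 (A *m w) ^+ 2)%:C =
    \sum_i d 0 i * ((Normc.normc ((P *m w) i 0)) ^+ 2)%:C.
  rewrite norm2_dot trmx_mul map_mxM /= mulmxA -[_ *m _ *m A]mulmxA -/H HE.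
  rewrite invmx_unitary // -!mulmxA !mulmxA -map_mxM -trmx_mul -mulmxA mxE.
  apply: eq_bigr => i _; rewrite mul_mx_diag !mxE.
  by rewrite mulrAC mulrC [in X in _ * X]mulrC -normCK rmorphXn.
have /unitarymxP PPt := uP.
(* [q i] is an eigenvector for [d 0 i]. Evaluating the formula there exhibits the a priori complex
   [d 0 i] as a squared norm, hence as a real number. *)
pose q (i : 'I_n) : 'cV[R[i]]_n := P^t* *m delta_mx i 0.
have dE i : (norm2 (A *m q i) ^+ 2)%:C = d 0 i.
  rewrite AwE /q mulmxA PPt mul1mx (bigD1 i) //= big1 => [|j ji].
    by rewrite addr0 mxE !eqxx Normc.normc1 expr1n mulr1.
  by rewrite mxE (negbTE ji) Normc.normc0 expr0n mulr0.
exists P => //; exists (fun i => norm2 (A *m q i) ^+ 2) => w.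
apply: complexI; rewrite AwE rmorph_sum; apply: eq_bigr => i _.
by rewrite -dE [RHS]rmorphM.
Qed.

(* The maximum of [norm2 (A *m w) / norm2 w] is reached at an eigenvector of
   [A^t* *m A] for its largest eigenvalue. *)
Lemma norm2_mul_attained (R : realType) n (A : 'M[R[i]]_n) : (0 < n)%N ->
  exists2 v : 'cV[R[i]]_n, norm2 v = 1 &
    forall w, norm2 (A *m w) <= norm2 (A *m v) * norm2 w.
Proof.
move=> n_gt0; have [P uP [d AwE]] := norm2_mul_spectral A.
have [m dm] : exists m, forall i, d i <= d m.
  case: (arg_maxP d (erefl : predT (Ordinal n_gt0))) => m _ dm.
  by exists m => i; exact: dm.
pose v : 'cV[R[i]]_n := P^t* *m delta_mx m 0.
have Pv : P *m v = delta_mx m 0.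
  by rewrite mulmxA (elimT unitarymxP uP) mul1mx.
have AvE : norm2 (A *m v) ^+ 2 = d m.
  rewrite AwE Pv (bigD1 m) //= big1 => [|j jm].
    by rewrite addr0 mxE !eqxx Normc.normc1 expr1n mulr1.
  by rewrite mxE (negbTE jm) Normc.normc0 expr0n mulr0.
exists v => [|w]; first by rewrite -(norm2_unitary v uP) Pv norm2_delta.
rewrite -[_ <= _]ler_sqr ?nnegrE ?mulr_ge0 ?norm2_ge0 //.
rewrite exprMn AvE AwE -(norm2_unitary w uP) norm2_sqr mulr_sumr.
by apply: ler_sum => i _; rewrite ler_wpM2r ?sqr_ge0.
Qed.

Lemma opnorm_attained (R : realType) n (A : 'M[R[i]]_n) : (0 < n)%N ->
  exists2 v : 'cV[R[i]]_n, norm2 v = 1 & opnorm A = norm2 (A *m v).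
Proof.
move=> n_gt0; have [v v1 Av] := norm2_mul_attained A n_gt0.
exists v => //; apply/eqP; rewrite eq_le; apply/andP; split.
  apply: ge_sup; first by exists (norm2 (A *m v)), v => //=; rewrite v1.
  move=> _ [w /= w1 <-]; apply: le_trans (Av w) _.
  by rewrite ler_piMr ?norm2_ge0.
apply: ub_le_sup; last by exists v => //=; rewrite v1.
(* A supremum dominates its elements only when the set is bounded above; the value at the maximiser
   is such a bound. *)
exists (norm2 (A *m v)) => _ [w /= w1 <-]; apply: le_trans (Av w) _.
by rewrite ler_piMr ?norm2_ge0.
Qed.

Lemma norm2_0 (R : realType) n : norm2 (0 : 'cV[R[i]]_n) = 0.
Proof.
by rewrite /norm2 big1 ?sqrtr0 // => i _; rewrite mxE Normc.normc0 expr0n.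
Qed.

Lemma normc_real (R : realType) (c : R) : 0 <= c -> Normc.normc c%:C = c.
Proof. by move=> c0; rewrite /= expr0n addr0 sqrtr_sqr ger0_norm. Qed.

Lemma norm2_mulmx (R : realType) n (A : 'M[R[i]]_n) (w : 'cV[R[i]]_n) :
  (0 < n)%N -> norm2 (A *m w) <= opnorm A * norm2 w.
Proof.
move=> n_gt0; have [v v1 Av] := norm2_mul_attained A n_gt0.
apply: le_trans (Av w) _; rewrite ler_wpM2r ?norm2_ge0 //.
apply: ub_le_sup; last by exists v => //=; rewrite v1.
exists (norm2 (A *m v)) => _ [u /= u1 <-]; apply: le_trans (Av u) _.
by rewrite ler_piMr ?norm2_ge0.
Qed.

Lemma opnorm_ge0 (R : realType) n (A : 'M[R[i]]_n) : (0 < n)%N -> 0 <= opnorm A.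
Proof. by move=> /(opnorm_attained A)[v _ ->]; exact: norm2_ge0. Qed.

Lemma opnorm_gt0 (R : realType) n (A : 'M[R[i]]_n) :
  (0 < n)%N -> A \in unitmx -> 0 < opnorm A.
Proof.
move=> n_gt0 uA; rewrite lt_def opnorm_ge0 // andbT; apply/eqP => A0.
have [v v1 _] := opnorm_attained A n_gt0.
have := norm2_mulmx A v n_gt0; rewrite A0 mul0r => Av_le0.
have /norm2_eq0 Av0 : norm2 (A *m v) = 0.
  by apply/eqP; rewrite eq_le Av_le0 norm2_ge0.
move: v1; rewrite -[v](mulKmx uA) Av0 mulmx0 norm2_0 => /eqP.
by rewrite eq_sym oner_eq0.
Qed.

Lemma opnorm_mul (R : realType) n (A B : 'M[R[i]]_n) :
  (0 < n)%N -> opnorm (A *m B) <= opnorm A * opnorm B.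
Proof.
move=> n_gt0; have [v v1 ->] := opnorm_attained (A *m B) n_gt0.
rewrite -mulmxA; apply: le_trans (norm2_mulmx _ _ n_gt0) _.
rewrite ler_wpM2l ?opnorm_ge0 //.
by apply: le_trans (norm2_mulmx _ _ n_gt0) _; rewrite v1 mulr1.
Qed.

(** * The condition number of a product *)

Lemma kappa_gt0 (R : realType) n (A : 'M[R[i]]_n) :
  (0 < n)%N -> A \in unitmx -> 0 < kappa A.
Proof. by move=> n_gt0 uA; rewrite mulr_gt0 ?opnorm_gt0 ?unitmx_inv. Qed.

Lemma invmxM (F : comUnitRingType) n (A B : 'M[F]_n) :
  A \in unitmx -> B \in unitmx -> invmx (A *m B) = invmx B *m invmx A.
Proof.
move=> uA uB; have uAB : A *m B \in unitmx by rewrite unitmx_mul uA.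
by rewrite -[RHS]mulmx1 -(mulmxV uAB) !mulmxA mulmxKV // mulVmx // mul1mx.
Qed.

Lemma kappa_mul (R : realType) n (A B : 'M[R[i]]_n) :
  (0 < n)%N -> A \in unitmx -> B \in unitmx ->
  kappa (A *m B) <= kappa A * kappa B.
Proof.
move=> n_gt0 uA uB; rewrite /kappa mulrACA invmxM //.
rewrite [X in _ <= _ * X]mulrC.
by rewrite ler_pM ?opnorm_ge0 ?opnorm_mul.
Qed.

(** * The operator norm of a Kronecker product *)

Lemma sum_tens (V : nmodType) m n (F : 'I_(m * n) -> V) :
  \sum_i F i = \sum_i \sum_j F (mxtens_index (i, j)).
Proof.
rewrite pair_bigA (reindex (@mxtens_index m n)) /=.
  by apply: eq_bigr => -[].
by apply: onW_bij; exists (@mxtens_unindex m n);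
  [exact: mxtens_indexK|exact: mxtens_unindexK].
Qed.

Lemma norm2_tens (R : realType) m n (v : 'cV[R[i]]_m) (w : 'cV[R[i]]_n) :
  norm2 (v *t w : 'cV[R[i]]_(m * n)) = norm2 v * norm2 w.
Proof.
apply/eqP; rewrite -(@eqrXn2 _ 2) ?norm2_ge0 ?mulr_ge0 ?norm2_ge0 //.
rewrite exprMn !norm2_sqr sum_tens mulr_suml; apply/eqP/eq_bigr => i _.
rewrite mulr_sumr; apply: eq_bigr => j _.
by rewrite !mxE mxtens_indexK !ord1 Normc.normcM exprMn.
Qed.

(** With the second index [j] fixed, the entries of [w] form a slice [u] on which [A *t 1] acts as
    [A]. Bounding each slice and summing the squares over [j] gives the claim. *)
Lemma norm2_mul_tens1 (R : realType) m n (A : 'M[R[i]]_m) (w : 'cV[R[i]]_(m * n)) :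
  (0 < m)%N -> norm2 ((A *t (1%:M : 'M[R[i]]_n)) *m w) <= opnorm A * norm2 w.
Proof.
move=> m_gt0; rewrite -[_ <= _]ler_sqr ?nnegrE ?mulr_ge0 ?opnorm_ge0 ?norm2_ge0 //.
rewrite exprMn !norm2_sqr !sum_tens [leLHS]exchange_big [X in _ * X]exchange_big.
rewrite mulr_sumr; apply: ler_sum => j _ /=.
pose u : 'cV[R[i]]_m := \col_i w (mxtens_index (i, j)) 0.
have -> : \sum_i Normc.normc (w (mxtens_index (i, j)) 0) ^+ 2 = norm2 u ^+ 2.
  by rewrite norm2_sqr; apply: eq_bigr => i _; rewrite mxE.
rewrite -exprMn (le_trans _ (_ : norm2 (A *m u) ^+ 2 <= _)) //; last first.
  by rewrite lerXn2r ?nnegrE ?mulr_ge0 ?norm2_ge0 ?opnorm_ge0 ?norm2_mulmx.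
rewrite norm2_sqr le_eqVlt; apply/orP; left; apply/eqP/eq_bigr => i _.
congr (Normc.normc _ ^+ 2); rewrite !mxE sum_tens; apply: eq_bigr => l _.
rewrite (bigD1 j) //= big1 => [|l' jl']; rewrite !mxE !mxtens_indexK /=.
  by rewrite eqxx mulr1 addr0.
by rewrite eq_sym (negbTE jl') mulr0 mul0r.
Qed.

(** The same argument, with slices of [w] at a fixed first index. *)
Lemma norm2_mul_1tens (R : realType) m n (B : 'M[R[i]]_n) (w : 'cV[R[i]]_(m * n)) :
  (0 < n)%N -> norm2 (((1%:M : 'M[R[i]]_m) *t B) *m w) <= opnorm B * norm2 w.
Proof.
move=> n_gt0; rewrite -[_ <= _]ler_sqr ?nnegrE ?mulr_ge0 ?opnorm_ge0 ?norm2_ge0 //.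
rewrite exprMn !norm2_sqr !sum_tens mulr_sumr; apply: ler_sum => j _ /=.
pose u : 'cV[R[i]]_n := \col_i w (mxtens_index (j, i)) 0.
have -> : \sum_i Normc.normc (w (mxtens_index (j, i)) 0) ^+ 2 = norm2 u ^+ 2.
  by rewrite norm2_sqr; apply: eq_bigr => i _; rewrite mxE.
rewrite -exprMn (le_trans _ (_ : norm2 (B *m u) ^+ 2 <= _)) //; last first.
  by rewrite lerXn2r ?nnegrE ?mulr_ge0 ?norm2_ge0 ?opnorm_ge0 ?norm2_mulmx.
rewrite norm2_sqr le_eqVlt; apply/orP; left; apply/eqP/eq_bigr => i _.
congr (Normc.normc _ ^+ 2).
rewrite !mxE sum_tens (bigD1 j) //= [X in _ + X]big1 => [|l' jl'].
  rewrite addr0; apply: eq_bigr => l _.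
  by rewrite !mxE !mxtens_indexK /= eqxx mul1r.
by rewrite big1 // => l _; rewrite !mxE !mxtens_indexK /= eq_sym (negbTE jl') !mul0r.
Qed.

(** The upper bound comes from factoring [A *t B] as [(A *t 1) *m (1 *t B)], the lower bound from
    the tensor of two maximising vectors. *)
Lemma opnorm_tens (R : realType) m n (A : 'M[R[i]]_m) (B : 'M[R[i]]_n) :
  (0 < m)%N -> (0 < n)%N ->
  opnorm (A *t B : 'M[R[i]]_(m * n)) = opnorm A * opnorm B.
Proof.
move=> m_gt0 n_gt0; have mn_gt0 : (0 < m * n)%N by rewrite muln_gt0 m_gt0.
apply/eqP; rewrite eq_le; apply/andP; split.
  have [v v1 ->] := opnorm_attained (A *t B) mn_gt0.
  rewrite tensmx_decr -mulmxA; apply: le_trans (norm2_mul_tens1 _ _ m_gt0) _.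
  rewrite ler_wpM2l ?opnorm_ge0 //.
  by apply: le_trans (norm2_mul_1tens _ _ n_gt0) _; rewrite v1 mulr1.
have [v v1 ->] := opnorm_attained A m_gt0.
have [w w1 ->] := opnorm_attained B n_gt0.
rewrite -norm2_tens -tensmx_mul; apply: le_trans (norm2_mulmx _ _ mn_gt0) _.
by rewrite norm2_tens v1 w1 !mulr1.
Qed.

(** * Positive definite matrices and vectors attaining their norm *)

Lemma hermsymmxE (R : realType) n (A : 'M[R[i]]_n) : A \is hermsymmx -> A^t* = A.
Proof. by move/is_hermitianmxP; rewrite expr0 scale1r => <-. Qed.

Lemma posdefmx_unit (R : realType) n (A : 'M[R[i]]_n) : posdefmx A -> A \in unitmx.
Proof.
(* Row freeness concerns row vectors, so it is used for [A^T]: a row killed by [A^T] is the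
   transpose of a column killed by [A]. *)
move=> [_ A_gt0]; rewrite -unitmx_tr -row_free_unit.
apply/inj_row_free => v vA; apply/eqP/negP => /negP v0.
have vT0 : v^T != 0 by rewrite trmx_eq0.
have := A_gt0 _ vT0; rewrite -mulmxA.
by rewrite -[A]trmxK -trmx_mul vA trmx0 mulmx0 mxE ltxx.
Qed.

(** The form of [invmx A] at [v] is the form of [A] at [invmx A *m v]. *)
Lemma posdefmx_inv (R : realType) n (A : 'M[R[i]]_n) :
  posdefmx A -> posdefmx (invmx A).
Proof.
move=> A_pd; have uA := posdefmx_unit A_pd; have [hA A_gt0] := A_pd.
have hAV : (invmx A)^t* = invmx A.
  by rewrite trmx_inv map_invmx (hermsymmxE hA).
split=> [|v v0]; first by apply/is_hermitianmxP; rewrite expr0 scale1r hAV.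
have Av0 : invmx A *m v != 0.
  by apply: contraNneq v0 => Av; rewrite -[v](mulKVmx uA) Av mulmx0.
have := A_gt0 _ Av0; rewrite trmx_mul map_mxM /= hAV.
by rewrite mulmxKV // mulmxA.
Qed.

(** With [c = opnorm A], expanding gives [|A^2 v - c^2 v|^2 = |A^2 v|^2 - 2 c^2 |A v|^2 + c^4
    |v|^2]. This is at most 0, because [|A v| = c |v|] and [|A^2 v| <= c^2 |v|]. Hence
    [A^2 v = c^2 v], and positivity then removes the square. *)
Lemma posdefmx_opnorm_eigen (R : realType) n (A : 'M[R[i]]_n) (v : 'cV[R[i]]_n) :
  (0 < n)%N -> posdefmx A -> norm2 (A *m v) = opnorm A * norm2 v ->
  A *m v = (opnorm A)%:C *: v.
Proof.
move=> n_gt0 [hA A_gt0] Av; set c := opnorm A in Av *.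
have c_ge0 : 0 <= c by exact: opnorm_ge0.
have conjc : Num.conj (c%:C : R[i]) = c%:C by exact: conjc_real.
have AAv : A *m (A *m v) = (c%:C ^+ 2) *: v.
  apply/eqP; rewrite -subr_eq0; apply/eqP/norm2_eq0/eqP.
  rewrite -sqrf_eq0 eq_le sqr_ge0 andbT -lecR norm2_dot.
  have -> : (A *m (A *m v) - c%:C ^+ 2 *: v)^t* =
      (A *m (A *m v))^t* - c%:C ^+ 2 *: v^t*.
    by rewrite linearB linearZ /= map_mxB map_mxZ rmorphXn /= conjc.
  rewrite mulmxBl !mulmxBr -!scalemxAl -!scalemxAr.
  have -> : (A *m (A *m v))^t* *m v = (A *m v)^t* *m (A *m v).
    by rewrite [in LHS]trmx_mul map_mxM /= (hermsymmxE hA) mulmxA.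
  have -> : v^t* *m (A *m (A *m v)) = (A *m v)^t* *m (A *m v).
    by rewrite [in RHS]trmx_mul map_mxM /= (hermsymmxE hA) !mulmxA.
  have entry (U V W : 'M[R[i]]_1) k : (U - k *: V - (k *: V - k *: (k *: W))) 0 0 =
      U 0 0 - k * V 0 0 - (k * V 0 0 - k * (k * W 0 0)) by rewrite !mxE.
  rewrite entry -!norm2_dot Av.
  have := norm2_mulmx A (A *m v) n_gt0; rewrite Av -/c => AAv_le.
  have {}AAv_le : norm2 (A *m (A *m v)) ^+ 2 <= (c * (c * norm2 v)) ^+ 2.
    by rewrite lerXn2r ?nnegrE ?mulr_ge0 ?norm2_ge0.
  rewrite -!rmorphXn -!rmorphM -!rmorphB lecR.
  rewrite -addrA; apply: le_trans (lerD AAv_le (lexx _)) _.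
  by rewrite le_eqVlt; apply/orP; left; apply/eqP; ring.
(* [A *m A *m v = c^2 v] makes [A *m v - c v] an eigenvector for [- c], which
   positivity of [A] excludes unless it vanishes. *)
apply/eqP; rewrite -subr_eq0; apply/negP => /negP u0.
have := A_gt0 _ u0; set u := A *m v - _.
have -> : u^t* *m A *m u = - c%:C *: (u^t* *m u).
  rewrite -mulmxA scalemxAr; congr (_ *m _).
  by rewrite mulmxBr AAv -scalemxAr scaleNr scalerBr scalerA -expr2 opprB.
rewrite mxE -norm2_dot mulNr oppr_gt0 -rmorphM ltcR ltNge.
by rewrite mulr_ge0 ?sqr_ge0.
Qed.

Lemma norm2_eq1_neq0 (R : realType) n (v : 'cV[R[i]]_n) : norm2 v = 1 -> v != 0.
Proof.
move=> v1; apply/eqP => v0; move/eqP: v1.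
by rewrite v0 norm2_0 eq_sym oner_eq0.
Qed.

(** At a unit vector [v] attaining [|A B|], the chain [|A||B| = |A B v| <= |A||B v| <= |A||B|]
    consists of equalities. *)
Lemma opnorm_mul_eigen (R : realType) n (A B : 'M[R[i]]_n) :
  (0 < n)%N -> posdefmx A -> posdefmx B ->
  opnorm (A *m B) = opnorm A * opnorm B ->
  exists v : 'cV[R[i]]_n, [/\ v != 0, A *m v = (opnorm A)%:C *: v &
    B *m v = (opnorm B)%:C *: v].
Proof.
move=> n_gt0 A_pd B_pd.
have [v v1 ->] := opnorm_attained (A *m B) n_gt0; rewrite -mulmxA => ABv.
have A_gt0 := opnorm_gt0 n_gt0 (posdefmx_unit A_pd).
have B_gt0 := opnorm_gt0 n_gt0 (posdefmx_unit B_pd).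
have normBv : norm2 (B *m v) = opnorm B.
  apply/eqP; rewrite eq_le; apply/andP; split.
    by have := norm2_mulmx B v n_gt0; rewrite v1 mulr1.
  by rewrite -(ler_pM2l A_gt0) -ABv norm2_mulmx.
have Bv : B *m v = (opnorm B)%:C *: v.
  by apply: posdefmx_opnorm_eigen; rewrite // v1 mulr1.
exists v; split; [exact: norm2_eq1_neq0| |exact: Bv].
apply: posdefmx_opnorm_eigen => //; rewrite v1 mulr1.
(* Since [B v = |B| v], the factor [|B|] cancels from [|A B v| = |A||B|], so [v] attains [|A|]
   too. *)
apply: (mulIf (lt0r_neq0 B_gt0)); rewrite -ABv Bv -scalemxAr norm2Z.
by rewrite normc_real 1?mulrC ?ltW.
Qed.

(** * Rank, trace and the commutator *)

Lemma trace0_le1 (F : pzRingType) r (M : 'M[F]_r) : (r <= 1)%N -> \tr M = 0 -> M = 0.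
Proof.
case: r M => [|[|//]] M _ trM; first by apply/matrixP => -[].
by rewrite [M]mx11_scalar -trace_mx11 trM raddf0.
Qed.

(** In a rank factorisation [Z = C R], the square matrix [R C] has size at most 1 and the trace of
    [Z], so it is 0, and [Z Z = C (R C) R]. *)
Lemma rank1_trace0_sqr (F : fieldType) n (Z : 'M[F]_n) :
  (\rank Z <= 1)%N -> \tr Z = 0 -> Z *m Z = 0.
Proof.
move=> rZ trZ; have ZE := mulmx_base Z.
have BC0 : row_base Z *m col_base Z = 0.
  by apply: trace0_le1 => //; rewrite mxtrace_mulC ZE.
by rewrite -[in LHS]ZE mulmxA -[_ *m row_base Z *m _]mulmxA BC0 mulmx0 mul0mx.
Qed.

(** Each column [Z e_j] has squared norm [e_j^t* Z^t* Z e_j = 0]. *)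
Lemma mul_trmxC_eq0 (R : realType) n (Z : 'M[R[i]]_n) : Z^t* *m Z = 0 -> Z = 0.
Proof.
move=> Z0; apply/matrixP => i j; rewrite [RHS]mxE.
suff : Z *m delta_mx j 0 = 0 :> 'cV_n.
  by rewrite -colE => /colP/(_ i); rewrite !mxE.
apply/norm2_eq0/eqP; rewrite -sqrf_eq0 -(inj_eq (@complexI R)) norm2_dot.
by rewrite trmx_mul map_mxM /= mulmxA -[_ *m _ *m Z]mulmxA Z0 mulmx0 mul0mx mxE.
Qed.

(* The commutator kills [v] and [w], so it has rank at most 1; being of trace 0
   it squares to 0, and being skew-Hermitian it vanishes. *)
Lemma commute_of_two_eigen (R : realType) n (A B : 'M[R[i]]_n)
    (v w : 'cV[R[i]]_n) (a a' b b' : R[i]) : (n <= 3)%N ->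
  A \is hermsymmx -> B \is hermsymmx -> v != 0 -> w != 0 -> a != a' ->
  A *m v = a *: v -> B *m v = b *: v -> A *m w = a' *: w -> B *m w = b' *: w ->
  A *m B = B *m A.
Proof.
move=> n3 hA hB v0 w0 aa' Av Bv Aw Bw.
set Z := A *m B - B *m A.
have ZtC : Z^t* = - Z.
  rewrite linearB /= map_mxB !trmx_mul !map_mxM /= (hermsymmxE hA) (hermsymmxE hB).
  by rewrite opprB.
have Zv : Z *m v = 0.
  rewrite mulmxBl -!mulmxA Av Bv -!scalemxAr Av Bv !scalerA [a * b]mulrC.
  by rewrite subrr.
have Zw : Z *m w = 0.
  rewrite mulmxBl -!mulmxA Aw Bw -!scalemxAr Aw Bw !scalerA [a' * b']mulrC.
  by rewrite subrr.
have rvw : \rank (row_mx v w) = 2%N.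
  rewrite -mxrank_tr; apply/eqP/inj_row_free => x.
  rewrite -[x]hsubmxK tr_row_mx mul_row_col [lsubmx x]mx11_scalar [rsubmx x]mx11_scalar.
  set s := lsubmx x 0 0; set t := rsubmx x 0 0.
  rewrite !mul_scalar_mx => /(congr1 trmx); rewrite linearD !linearZ /= !trmxK trmx0.
  move=> vw0; have := congr1 (mulmx A) vw0.
  rewrite mulmxDr mulmx0 -!scalemxAr Av Aw => Avw0.
  (* Applying [A] to [s v + t w = 0] and subtracting [a'] times that relation eliminates [w]. *)
  have : (s * (a - a')) *: v = 0.
    rewrite mulrBr scalerBl -scalerA -[RHS](subrr 0) -{1}Avw0 -(scaler0 _ a') -vw0.
    rewrite scalerDr !scalerA [a' * s]mulrC [a' * t]mulrC.
    by rewrite opprD [X in _ = X]addrACA subrr addr0.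
  move/eqP; rewrite scaler_eq0 (negbTE v0) orbF mulf_eq0 subr_eq0 (negbTE aa') orbF.
  move=> /eqP s0; move: vw0; rewrite s0 scale0r add0r => /eqP.
  rewrite scaler_eq0 (negbTE w0) orbF => /eqP t0.
  by rewrite t0 raddf0 row_mx0.
have rZ : (\rank Z <= 1)%N.
  have : Z *m row_mx v w = 0 by rewrite mul_mx_row Zv Zw row_mx0.
  (* Factors with product 0 have ranks summing to at most [n], and [n <= 3]. *)
  move/mulmx0_rank_max; rewrite rvw => rZ2.
  by rewrite -(leq_add2r 2) (leq_trans rZ2).
have trZ : \tr Z = 0 by rewrite linearB /= mxtrace_mulC subrr.
have ZZ := rank1_trace0_sqr rZ trZ.
apply/eqP; rewrite -subr_eq0; apply/eqP/mul_trmxC_eq0.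
by rewrite ZtC mulNmx ZZ oppr0.
Qed.

(** * Equality in the submultiplicativity of the condition number *)

Lemma realc_neq0 (R : realType) (c : R) : 0 < c -> c%:C != 0 :> R[i].
Proof.
by move=> c_gt0; rewrite -(rmorph0 (real_complex R)) (inj_eq (@complexI R)) gt_eqF.
Qed.

Lemma eq_of_mul_eq_le (R : realFieldType) (a b c d : R) :
  0 < a -> 0 < b -> a <= c -> b <= d -> a * b = c * d -> a = c /\ b = d.
Proof.
move=> a0 b0 ac bd abcd; split; apply/eqP; rewrite eq_le ?ac ?bd leNgt /=.
  apply/negP => lt_ac; have : a * b < c * d.
    apply: (@lt_le_trans _ _ (c * b)); first by rewrite ltr_pM2r.
    by rewrite ler_pM2l // (lt_trans a0).
  by rewrite abcd ltxx.
apply/negP => lt_bd; have : a * b < c * d.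
  apply: (@le_lt_trans _ _ (c * b)); first by rewrite ler_pM2r.
  by rewrite ltr_pM2l // (lt_le_trans a0).
by rewrite abcd ltxx.
Qed.

Lemma kappa_mul_commute (R : realType) n (A B : 'M[R[i]]_n) :
  (0 < n <= 3)%N -> posdefmx A -> posdefmx B ->
  kappa (A *m B) = kappa A * kappa B -> A *m B = B *m A.
Proof.
move=> /andP[n_gt0 n3] A_pd B_pd.
have [uA uB] := (posdefmx_unit A_pd, posdefmx_unit B_pd).
have [AV_pd BV_pd] := (posdefmx_inv A_pd, posdefmx_inv B_pd).
have [uAV uBV] := (posdefmx_unit AV_pd, posdefmx_unit BV_pd).
rewrite /kappa invmxM // [in RHS]mulrACA [X in _ = _ * X]mulrC => kAB.
have uBVAV : invmx B *m invmx A \in unitmx by rewrite unitmx_mul uBV.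
have uAB : A *m B \in unitmx by rewrite unitmx_mul uA.
have [ABE BVAVE] := eq_of_mul_eq_le (opnorm_gt0 n_gt0 uAB) (opnorm_gt0 n_gt0 uBVAV)
  (opnorm_mul _ _ n_gt0) (opnorm_mul _ _ n_gt0) kAB.
have [v [v0 Av Bv]] := opnorm_mul_eigen n_gt0 A_pd B_pd ABE.
have [w [w0 BVw AVw]] := opnorm_mul_eigen n_gt0 BV_pd AV_pd BVAVE.
have A_gt0 := opnorm_gt0 n_gt0 uA; have AV_gt0 := opnorm_gt0 n_gt0 uAV.
(* Carries the eigenvector [w] from the inverses back to [A] and [B], with reciprocal
   eigenvalues. *)
have inv_eigen (C : 'M[R[i]]_n) (c : R) : C \in unitmx -> 0 < c ->
    invmx C *m w = c%:C *: w -> C *m w = (c%:C)^-1 *: w.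
  move=> uC c_gt0 CVw; have c0 := realc_neq0 c_gt0.
  by rewrite -[in RHS](mulKVmx uC w) CVw -scalemxAr scalerA mulVf // scale1r.
have BV_gt0 := opnorm_gt0 n_gt0 uBV.
have Aw := inv_eigen _ _ uA AV_gt0 AVw; have Bw := inv_eigen _ _ uB BV_gt0 BVw.
have [hA _] := A_pd; have [hB _] := B_pd.
(* The eigenvalues of [A] at [v] and [w] are compared. If they differ, the commutator argument
   applies; if they agree, [kappa A = 1] and [A] is scalar. *)
have [cE|cN] := eqVneq (opnorm A)%:C ((opnorm (invmx A))%:C^-1 : R[i]); last first.
  exact: (commute_of_two_eigen n3 hA hB v0 w0 cN Av Bv Aw Bw).
have cE' : opnorm A * opnorm (invmx A) = 1.
  apply: complexI; rewrite rmorphM /= cE.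
  by rewrite mulVf; last exact: realc_neq0.
have A_scalar : A = ((opnorm A)%:C)%:M.
  have AE (u : 'cV[R[i]]_n) : A *m u = (opnorm A)%:C *: u.
    apply: posdefmx_opnorm_eigen => //; apply/eqP; rewrite eq_le norm2_mulmx //=.
    (* From [|u| <= |A^-1||A u|] and [|A||A^-1| = 1], every [u] attains the norm of [A]. *)
    rewrite -[X in _ * norm2 X](mulKmx uA u).
    apply: le_trans (ler_wpM2l (ltW A_gt0) (norm2_mulmx _ _ n_gt0)) _.
    by rewrite mulrA cE' mul1r.
  apply/matrixP => i j; have := AE (delta_mx j 0); rewrite -colE => /colP/(_ i).
  by rewrite !mxE => ->; rewrite eqxx andbT mulr_natr.
by rewrite A_scalar scalar_mxC.
Qed.

(** * Iterated Kronecker products *)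

Lemma tensmx1 (F : comPzRingType) m n :
  (1%:M : 'M[F]_m) *t (1%:M : 'M[F]_n) = 1%:M.
Proof.
apply/matrixP => i j; case: (mxtens_indexP i) => i1 i2; case: (mxtens_indexP j) => j1 j2.
rewrite tensmxE !mxE (can_eq (@mxtens_indexK m n)) xpair_eqE.
by case: (i1 == j1); case: (i2 == j2); rewrite ?mulr1 ?mulr0.
Qed.

Lemma invmx_tens (F : comUnitRingType) m n (A : 'M[F]_m) (B : 'M[F]_n) :
  A \in unitmx -> B \in unitmx ->
  (A *t B \in unitmx) /\ invmx (A *t B) = invmx A *t invmx B.
Proof.
move=> uA uB; have ABV : (A *t B) *m (invmx A *t invmx B) = 1%:M.
  by rewrite tensmx_mul !mulmxV // tensmx1.
have [uAB _] := mulmx1_unit ABV; split=> //.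
by rewrite -[RHS](mulKmx uAB) ABV mulmx1.
Qed.

Lemma kron_size_gt0 k (n : 'I_k.+1 -> nat) :
  (forall i, 0 < n i)%N -> (0 < kron_size n)%N.
Proof. by elim: k n => [|k IHk] n n_gt0 /=; rewrite ?muln_gt0 ?n_gt0 ?IHk. Qed.

Lemma kron_unit (F : comUnitRingType) k (n : 'I_k.+1 -> nat)
    (X : forall i, 'M[F]_(n i)) :
  (forall i, X i \in unitmx) -> kron X \in unitmx.
Proof.
elim: k n X => [|k IHk] n X uX /=; first exact: uX.
by have [] := invmx_tens (uX ord0) (IHk _ _ (fun i => uX (lift ord0 i))).
Qed.

Lemma kron_mul (F : comPzRingType) k (n : 'I_k.+1 -> nat)
    (X Y : forall i, 'M[F]_(n i)) :
  kron X *m kron Y = kron (fun i => X i *m Y i).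
Proof. by elim: k n X Y => [|k IHk] n X Y //=; rewrite tensmx_mul IHk. Qed.

Lemma kappa_kron (R : realType) k (n : 'I_k.+1 -> nat)
    (X : forall i, 'M[R[i]]_(n i)) :
  (forall i, 0 < n i)%N -> (forall i, X i \in unitmx) ->
  kappa (kron X) = \prod_i kappa (X i).
Proof.
elim: k n X => [|k IHk] n X n_gt0 uX; first by rewrite big_ord_recl big_ord0 mulr1.
rewrite big_ord_recl -IHk // /kappa /=.
(* The inverse of a Kronecker product is split using the invertibility of both factors. *)
have uX' := kron_unit (fun i => uX (lift ord0 i)).
have [_ ->] := invmx_tens (uX ord0) uX'.
by rewrite !opnorm_tens ?kron_size_gt0 // mulrACA.
Qed.

(** * From equality of products to equality of factors *)

(** Isolating the factor at [i] reduces to two factors, the second being the product over the other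
    indices. *)
Lemma eq_of_prod_eq_le (R : realFieldType) (I : finType) (a b : I -> R) :
  (forall i, 0 < a i) -> (forall i, a i <= b i) ->
  \prod_i a i = \prod_i b i -> a =1 b.
Proof.
move=> a_gt0 ab eq_ab i; have b_gt0 j : 0 < b j := lt_le_trans (a_gt0 j) (ab j).
move: eq_ab; rewrite (bigD1 i) // [RHS](bigD1 i) //= => eq_ab.
have le_prod : \prod_(j | j != i) a j <= \prod_(j | j != i) b j.
  by apply: ler_prod => j _; rewrite ltW ?ab.
have prod_gt0 : 0 < \prod_(j | j != i) a j by apply: prodr_gt0.
by have [] := eq_of_mul_eq_le (a_gt0 i) prod_gt0 (ab i) le_prod eq_ab.
Qed.

(** Positivity places both sides where [ln] is injective and turns sums into products. *)
Lemma eqM_of_half_ln (R : realType) (a b c : R) : 0 < a -> 0 < b -> 0 < c ->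
  2^-1 * ln a = 2^-1 * ln b + 2^-1 * ln c -> a = b * c.
Proof.
move=> a_gt0 b_gt0 c_gt0; rewrite -mulrDr -lnM ?posrE //.
have half_neq0 : 2^-1 != 0 :> R by rewrite invr_eq0 pnatr_eq0.
by move=> /(mulfI half_neq0)/ln_inj; apply; rewrite posrE ?mulr_gt0.
Qed.

Theorem proposition4p13 (R : realType) (k : nat) (n : 'I_k.+1 -> nat)
  (n_gt0 : forall i, (0 < n i)%N)
  (X Y : forall i, 'M[R[i]]_(n i))
  (X_pd : forall i, posdefmx (X i)) (Y_pd : forall i, posdefmx (Y i))
  (OLC_XY : OLC (kron X *m kron Y) = OLC (kron X) + OLC (kron Y)) :
  (forall i, kappa (X i *m Y i) = kappa (X i) * kappa (Y i)) /\
  ((forall i, (n i <= 3)%N) ->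
     (forall i, X i *m Y i = Y i *m X i) /\
     kron X *m kron Y = kron Y *m kron X).
Proof.
have uX i := posdefmx_unit (X_pd i); have uY i := posdefmx_unit (Y_pd i).
have uXY i : X i *m Y i \in unitmx by rewrite unitmx_mul uX uY.
have N_gt0 := kron_size_gt0 n_gt0.
have kX_gt0 := kappa_gt0 N_gt0 (kron_unit uX).
have kY_gt0 := kappa_gt0 N_gt0 (kron_unit uY).
have kXY : kappa (kron X *m kron Y) = kappa (kron X) * kappa (kron Y).
  have kXY_gt0 : 0 < kappa (kron X *m kron Y).
    by rewrite kappa_gt0 // unitmx_mul !kron_unit.
  exact (eqM_of_half_ln kXY_gt0 kX_gt0 kY_gt0 OLC_XY).
(* By the mixed product rule, [kron X *m kron Y] is itself an iterated Kronecker product. *)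
have eq_prod : \prod_i kappa (X i *m Y i) = \prod_i (kappa (X i) * kappa (Y i)).
  transitivity (kappa (kron X *m kron Y)).
    by rewrite kron_mul (kappa_kron n_gt0 uXY).
  by rewrite kXY (kappa_kron n_gt0 uX) (kappa_kron n_gt0 uY) [RHS]big_split.
have kXYi : forall i, kappa (X i *m Y i) = kappa (X i) * kappa (Y i).
  by apply: eq_of_prod_eq_le eq_prod => i; [exact: kappa_gt0|exact: kappa_mul].
split=> // n3.
have XYC i : X i *m Y i = Y i *m X i.
  by apply: kappa_mul_commute; rewrite ?n_gt0 ?n3.
(* Both sides are Kronecker products of dependent families, which agree at each index. *)
split=> //; rewrite !kron_mul; congr kron.
by apply: functional_extensionality_dep => i; exact: XYC.
Qed.
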